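(* For all $n\ge2$ and $P,Q\in\Gamma_n$, the function $s\mapsto\mathcal V_s(P\Vert Q)$ is monotonically increasing (in the weak sense) on $s\ge\frac12$ and monotonically decreasing (in the weak sense) on $s\le\frac12$.
   Context: $\Gamma_n=\{P=(p_1,\dots,p_n): p_i>0,\ \sum_{i=1}^n p_i=1\}$. For $P,Q\in\Gamma_n$ and $s\in\mathbb{R}$, $$\mathcal V_s(P\Vert Q)=\begin{cases}[s(s-1)]^{-1}\left[\sum_{i=1}^n\left(p_i^sq_i^{1-s}+p_i^{1-s}q_i^s\right)-2\right], & s\ne0,1,\\[4pt] J(P\Vert Q)=\sum_{i=1}^n (p_i-q_i)\ln\left(\frac{p_i}{q_i}\right), & s=0,1.\end{cases}$$ *)

(* Defs.v *)
From mathcomp Require Import all_boot all_order all_algebra.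
From mathcomp Require Import all_classical all_reals all_analysis.

Set Implicit Arguments.
Unset Strict Implicit.
Unset Printing Implicit Defensive.

Import Order.TTheory GRing.Theory Num.Theory.

Local Open Scope ring_scope.
Local Open Scope classical_set_scope.

Definition Gamma (R : realType) (n : nat) : set ('I_n -> R) :=
  [set P | (forall i, 0 < P i) /\ \sum_(i < n) P i = 1].

Definition J_divergence (R : realType) (n : nat) (P Q : 'I_n -> R) : R :=
  \sum_(i < n) (P i - Q i) * ln (P i / Q i).

Definition V_divergence (R : realType) (n : nat) (P Q : 'I_n -> R) (s : R) : R :=
  if (s == 0) || (s == 1) then J_divergence P Q
  else (s * (s - 1))^-1 *
       (\sum_(i < n) (P i `^ s * Q i `^ (1 - s) + P i `^ (1 - s) * Q i `^ s) - 2).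

(* Main.v *)
Require Import Defs.
From mathcomp Require Import all_boot all_order all_algebra.
From mathcomp Require Import all_classical all_reals all_analysis.
From mathcomp Require Import ring lra.

Set Implicit Arguments.
Unset Strict Implicit.
Unset Printing Implicit Defensive.

Import Order.TTheory GRing.Theory Num.Theory.

Local Open Scope ring_scope.

(** Put x_i = ln (p_i / q_i) and a = s - 1/2.  Then
    p_i^s q_i^(1-s) + p_i^(1-s) q_i^s = 2 sqrt(p_i q_i) cosh(a x_i),
    so the sum in the divergence is H(a), where
    H(a) = sum_i 2 sqrt(p_i q_i) cosh(a x_i).  Moreover H(1/2) = sum_i (p_i + q_i)
    = 2 and s (s - 1) = a^2 - (1/2)^2, so away from s = 0, 1 the divergence is
    the difference quotient (H(a) - H(1/2)) / (a^2 - (1/2)^2)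
    [V_divergenceE].  Now H is a convex function of the variable a^2, because
    cosh(sqrt u) is convex in u, and the value J given to the divergence at
    s = 0, 1 is the slope of H at a^2 = 1/4 [J_subgradient].  The difference
    quotients of a convex function from a fixed point increase
    [slope_from_le]; hence the divergence increases with a^2, that is with s
    when s >= 1/2.  The symmetry s <-> 1 - s gives the other half.

    Convexity is used only through supporting lines, which for cosh amount to
    sinh b (c^2 - b^2) <= 2 b (cosh c - cosh b) for b, c >= 0
    [cosh_tangent_nneg].  This follows from the monotonicity of sinh y / y on
    y > 0 [sinh_slope], and avoids differentiating cosh(sqrt u) at u = 0. *)

(** * Difference quotients of a convex function *)

(** The index b is sent to the abscissa g b and to the ordinate h b, and k is
    the slope of a supporting line at b.  Keeping the abscissa g separate allows
    one to speak of a function of a being convex in a^2. *)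
Definition subgradient (R : realType) (T : Type) (g h : T -> R) (b : T) (k : R) :=
  forall c, h b + k * (g c - g b) <= h c.

(** At abscissa g b the chord degenerates, and k stands for the derivative. *)
Definition slope_from (R : realType) (T : Type) (g h : T -> R) (b : T) (k : R)
    (a : T) : R :=
  if g a == g b then k else (h a - h b) / (g a - g b).

(** Any supporting line at the one of b, c, d whose abscissa is in the middle
    separates the slopes of the two chords between it and its neighbours, and the
    slope of the chord between the outer points is a mean of these two.  When c
    or d is in the middle, its abscissa is not the least one, hence the restriction in the
    second hypothesis: a convex function on [0, +oo[ may have no supporting line
    at 0. *)
Lemma slope_from_le (R : realType) (T : Type) (g h : T -> R) (b : T) (k : R) :
  subgradient g h b k ->
  (forall m, (exists a, g a < g m) -> exists l, subgradient g h m l) ->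
  forall c d, g c < g d -> slope_from g h b k c <= slope_from g h b k d.
Proof.
move=> kb hg c d cd; rewrite /slope_from.
have hc := kb c; have hd := kb d.
have [cb|bc|cb] := ltgtP (g c) (g b); have [db|bd|db] := ltgtP (g d) (g b);
  rewrite ?lt_eqF ?gt_eqF//; try lra.
- (* c < d < b in abscissa: the negations make the denominators positive *)
  have [l lc] := hg d (ex_intro _ c cd).
  have := lc c; have := lc b => lb lc'.
  rewrite -[leLHS]mulrNN -[leRHS]mulrNN -!invrN !opprB.
  rewrite ler_pdivrMr ?subr_gt0// mulrAC ler_pdivlMr ?subr_gt0//.
  nra.
- (* c < b < d in abscissa: k lies between the two slopes *)
  apply: (@le_trans _ _ k).
    by rewrite -[leLHS]mulrNN -invrN !opprB ler_pdivrMr ?subr_gt0//; lra.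
  by rewrite ler_pdivlMr ?subr_gt0//; lra.
- by rewrite -[leLHS]mulrNN -invrN !opprB ler_pdivrMr ?subr_gt0//; lra.
- (* b < c < d in abscissa *)
  have [l lc] := hg c (ex_intro _ b bc).
  have := lc d; have := lc b => lb lc'.
  rewrite ler_pdivrMr ?subr_gt0// mulrAC ler_pdivlMr ?subr_gt0//.
  nra.
- by rewrite ler_pdivlMr ?subr_gt0//; lra.
Qed.

(** * The hyperbolic cosine is convex in the square of its argument *)

Section Hyperbolic.
Import numFieldNormedType.Exports.
Local Open Scope classical_set_scope.
Local Open Scope ring_scope.
Variable R : realType.
Implicit Types x a b c : R.

Definition cosh x : R := (expR x + expR (- x)) / 2.
Definition sinh x : R := (expR x - expR (- x)) / 2.

Lemma sinh0 : sinh 0 = 0 :> R.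
Proof. by rewrite /sinh oppr0 subrr mul0r. Qed.

Lemma coshN x : cosh (- x) = cosh x.
Proof. by rewrite /cosh opprK addrC. Qed.

Lemma sinhN x : sinh (- x) = - sinh x.
Proof. by rewrite /sinh opprK -mulNr opprB. Qed.

#[local] Instance is_derive_expRN x :
  is_derive x 1 (fun y : R => expR (- y)) (- expR (- x)).
Proof.
apply: (is_derive_eq (is_derive1_comp (f := expR) (g := -%R) _ _)).
by rewrite mulrN1.
Qed.

#[local] Instance is_derive_cosh x : is_derive x 1 cosh (sinh x).
Proof.
have -> : cosh = 2^-1 \*: (expR + (fun y => expR (- y))).
  by apply/funext => y; rewrite /cosh mulrC.
by apply: is_derive_eq; rewrite /sinh mulrC.
Qed.

#[local] Instance is_derive_sinh x : is_derive x 1 sinh (cosh x).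
Proof.
have -> : sinh = 2^-1 \*: (expR - (fun y => expR (- y))).
  by apply/funext => y; rewrite /sinh mulrC.
by apply: is_derive_eq; rewrite opprK /cosh mulrC.
Qed.

Lemma is_derive_ge0_le (f df : R -> R) a b :
  (forall x, is_derive x 1 f (df x)) -> a <= b ->
  (forall x, a <= x <= b -> 0 <= df x) -> f a <= f b.
Proof.
move=> fdf ab df0.
have cf : {within `[a, b], continuous f}.
  apply: derivable_within_continuous => x _.
  by have := fdf x => -[].
have [c cab E] := MVT_segment ab (fun x _ => fdf x) cf.
by rewrite -subr_ge0 E mulr_ge0 ?subr_ge0// df0.
Qed.

Lemma sinh_ge0 x : 0 <= x -> 0 <= sinh x.
Proof. by move=> x0; rewrite /sinh divr_ge0// subr_ge0 ler_expR; lra. Qed.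

Lemma cosh_le a b : 0 <= a -> a <= b -> cosh a <= cosh b.
Proof.
move=> a0 ab; apply: (is_derive_ge0_le _ ab) => x /andP[ax _].
exact/sinh_ge0/(le_trans a0).
Qed.

Lemma sinh_le_mul_cosh x : 0 <= x -> sinh x <= x * cosh x.
Proof.
move=> x0; rewrite -subr_ge0.
have := @is_derive_ge0_le (fun y => y * cosh y - sinh y)
  (fun y => y * sinh y) 0 x _ x0.
rewrite /= mul0r sinh0 subr0; apply.
  move=> y.
  apply: (@is_derive_eq _ _ _ _ y 1 _ _ (is_deriveB (f := id * cosh) _ _)).
  by rewrite /GRing.scale /=; ring.
by move=> y /andP[y0 _]; rewrite mulr_ge0// sinh_ge0.
Qed.

(** This says that sinh y / y increases on y > 0: in y, the difference of the two
    sides has derivative b cosh y - sinh b >= b cosh b - sinh b >= 0. *)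
Lemma sinh_slope b c : 0 <= b -> b <= c -> c * sinh b <= b * sinh c.
Proof.
move=> b0 bc; rewrite -subr_ge0.
have := @is_derive_ge0_le (fun y => b * sinh y - y * sinh b)
  (fun y => b * cosh y - sinh b) b c _ bc.
rewrite /= subrr; apply.
  move=> y.
  apply: (@is_derive_eq _ _ _ _ y 1 _ _
    (is_deriveB (f := cst b * sinh) (g := id * cst (sinh b)) _ _)).
  by rewrite /GRing.scale /=; ring.
move=> y /andP[bley _].
rewrite subr_ge0 (le_trans (sinh_le_mul_cosh b0))//.
exact/ler_wpM2l/cosh_le.
Qed.

(** As a function of c, the right side minus the left side vanishes at c = b, and
    by [sinh_slope] its derivative 2 (b sinh c - c sinh b) has the sign of
    c - b. *)
Lemma cosh_tangent_nneg b c : 0 <= b -> 0 <= c ->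
  sinh b * (c ^+ 2 - b ^+ 2) <= 2 * b * (cosh c - cosh b).
Proof.
move=> b0 c0.
pose f y := 2 * b * cosh y - sinh b * y ^+ 2.
pose df y := 2 * (b * sinh y - y * sinh b).
have fdf (y : R) : is_derive y 1 f (df y).
  have -> : f = cst (2 * b) * cosh - cst (sinh b) * (id * id) by [].
  apply: is_derive_eq.
  by rewrite /GRing.scale /df /=; ring.
suff : f b <= f c by rewrite /f; lra.
have [bc|/ltW cb] := leP b c.
  apply: (is_derive_ge0_le fdf) => // y /andP[bley _].
  by rewrite mulr_ge0// subr_ge0 sinh_slope.
rewrite -lerN2.
apply: (@is_derive_ge0_le (- f) (fun y => - df y)) => // y /andP[cy yb].
by rewrite oppr_ge0 pmulr_rle0 ?subr_le0 ?sinh_slope// (le_trans c0).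
Qed.

(** The extra factor b makes both sides even in b and in c, so that signs do not
    matter. *)
Lemma cosh_tangent b c :
  b * sinh b * (c ^+ 2 - b ^+ 2) <= 2 * b ^+ 2 * (cosh c - cosh b).
Proof.
wlog b0 : b / 0 <= b => [hb|].
  have [/hb//|/ltW b0] := leP 0 b.
  by have := hb (- b); rewrite oppr_ge0 sinhN coshN mulrNN sqrrN; apply.
wlog c0 : c / 0 <= c => [hc|].
  have [/hc//|/ltW c0] := leP 0 c.
  by have := hc (- c); rewrite oppr_ge0 coshN sqrrN; apply.
have := ler_wpM2l b0 (cosh_tangent_nneg b0 c0).
by rewrite expr2 !mulrA [b * 2]mulrC.
Qed.

Lemma cosh_subgradient x b : b != 0 ->
  subgradient (fun a => a ^+ 2) (fun a => cosh (a * x)) b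
    (x * sinh (b * x) / (2 * b)).
Proof.
move=> b_neq0 c.
have [->|x_neq0] := eqVneq x 0; first by rewrite !mulr0 !mul0r addr0.
have /= := cosh_tangent (b * x) (c * x).
have -> : b * x * sinh (b * x) * ((c * x) ^+ 2 - (b * x) ^+ 2) =
    2 * (b * x) ^+ 2 *
      (x * sinh (b * x) / (2 * b) * (c ^+ 2 - b ^+ 2)) by field.
by rewrite ler_pM2l ?lerBrDl// mulr_gt0// exprn_even_gt0// mulf_neq0.
Qed.

End Hyperbolic.

(** * The divergence as a slope *)

Section Divergence.
Variable R : realType.
Implicit Types (p q s a b : R).

(** The geometric mean sqrt(p q), in the form that combines with exponentials. *)
Definition geom_mean p q : R := expR ((ln p + ln q) / 2).

Definition log_ratio p q : R := ln p - ln q.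

Lemma powR_pairE p q s : 0 < p -> 0 < q ->
  p `^ s * q `^ (1 - s) + p `^ (1 - s) * q `^ s =
  2 * geom_mean p q * cosh ((s - 2^-1) * log_ratio p q).
Proof.
move=> p0 q0; rewrite /powR !gt_eqF// /geom_mean /log_ratio /cosh -!expRD.
have E (e y : R) : 2 * e * (y / 2) = e * y by field.
rewrite E mulrDr -!expRD.
by congr (expR _ + expR _); field.
Qed.

Variables (n : nat) (P Q : 'I_n -> R).
Hypotheses (P_Gamma : Gamma P) (Q_Gamma : Gamma Q).

Let H a : R :=
  \sum_(i < n) 2 * geom_mean (P i) (Q i) * cosh (a * log_ratio (P i) (Q i)).

(** The tangent slope of H in the variable a^2, that is H'(b) / (2 b). *)
Let dH b : R :=
  \sum_(i < n) 2 * geom_mean (P i) (Q i) *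
    (log_ratio (P i) (Q i) * sinh (b * log_ratio (P i) (Q i)) / (2 * b)).

Lemma V_divergenceE s :
  V_divergence P Q s =
  slope_from (fun a => a ^+ 2) H 2^-1 (J_divergence P Q) (s - 2^-1).
Proof.
case: P_Gamma Q_Gamma => P0 P1 [Q0 Q1].
have HE t : \sum_(i < n) (P i `^ t * Q i `^ (1 - t) + P i `^ (1 - t) * Q i `^ t)
    = H (t - 2^-1) by apply: eq_bigr => i _; exact: powR_pairE.
(* at s = 1 the sum is that of the P i + Q i *)
have H2 : H 2^-1 = 2.
  rewrite (_ : 2^-1 = 1 - 2^-1); last by field.
  rewrite -HE; under eq_bigr do rewrite subrr !powRr0 !powRr1 ?ltW// mulr1 mul1r.
  by rewrite big_split /= P1 Q1.
rewrite /V_divergence /slope_from H2 HE.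
rewrite -[_ ^+ 2 == _]subr_eq0.
have -> : (s - 2^-1) ^+ 2 - 2^-1 ^+ 2 = s * (s - 1) by field.
by rewrite mulf_eq0 subr_eq0 [_ / _]mulrC.
Qed.

Lemma H_subgradient b : b != 0 -> subgradient (fun a => a ^+ 2) H b (dH b).
Proof.
move=> b0 c; rewrite mulr_suml -big_split /=; apply: ler_sum => i _.
rewrite -[X in _ + X]mulrA -mulrDr ler_wpM2l ?mulr_ge0 ?expR_ge0//.
exact: cosh_subgradient.
Qed.

(** Since p and q are sqrt(p q) times the exponentials of x / 2 and - x / 2, the
    slope 2 sqrt(p q) x sinh(x / 2) at b = 1/2 is the term (p - q) x of J. *)
Lemma J_subgradient :
  subgradient (fun a => a ^+ 2) H 2^-1 (J_divergence P Q).
Proof.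
case: P_Gamma Q_Gamma => P0 _ [Q0 _].
suff -> : J_divergence P Q = dH 2^-1 by exact: H_subgradient.
apply: eq_bigr => i _; rewrite ln_div ?posrE// /geom_mean /log_ratio.
rewrite -{1}[P i]lnK ?posrE// -{1}[Q i]lnK ?posrE//.
set p := ln (P i); set q := ln (Q i).
have -> : expR p = expR ((p + q) / 2) * expR (2^-1 * (p - q)).
  by rewrite -expRD; congr expR; field.
have -> : expR q = expR ((p + q) / 2) * expR (- (2^-1 * (p - q))).
  by rewrite -expRD; congr expR; field.
by rewrite /sinh; field.
Qed.

Lemma V_divergence_le (s t : R) : 2^-1 <= s -> s <= t ->
  V_divergence P Q s <= V_divergence P Q t.
Proof.
move=> s_ge; rewrite le_eqVlt => /predU1P[->//|st].
rewrite !V_divergenceE; apply: slope_from_le J_subgradient _ _ _ _.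
  (* a point whose square is not the least one is nonzero *)
  move=> b [a ab]; exists (dH b); apply: H_subgradient.
  by apply: contraTneq ab => ->; rewrite expr0n /= -leNgt sqr_ge0.
by rewrite ltr_pXn2r ?nnegrE //; lra.
Qed.

End Divergence.

Lemma V_divergenceC (R : realType) (n : nat) (P Q : 'I_n -> R) (s : R) :
  V_divergence P Q (1 - s) = V_divergence P Q s.
Proof.
rewrite /V_divergence.
rewrite subr_eq0 [1 == s]eq_sym -[1 - s == 1]subr_eq0 addrAC subrr add0r oppr_eq0.
rewrite orbC subKr; case: ifP => // _; congr (_^-1 * (_ - _)); first by ring.
by apply: eq_bigr => i _; rewrite addrC.
Qed.

Theorem mainTheorem4 (R : realType) (n : nat) (n_ge2 : (2 <= n)%N)
    (P Q : 'I_n -> R) (P_Gamma : Gamma P) (Q_Gamma : Gamma Q) :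
  (forall s t : R, 2^-1 <= s -> s <= t -> V_divergence P Q s <= V_divergence P Q t) /\
  (forall s t : R, s <= t -> t <= 2^-1 -> V_divergence P Q t <= V_divergence P Q s).
Proof.
split=> [s t|s t st t_le]; first exact: V_divergence_le.
rewrite -(V_divergenceC P Q s) -(V_divergenceC P Q t).
by apply: V_divergence_le => //; lra.
Qed.
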